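(* Let $T>0$, $n\ge1$, and let $A$ be a nonempty compact subset of some $\mathbb{R}^m$. Suppose that $f:[0,T]\times\mathbb{R}^n\times A\to\mathbb{R}^n$ and $l:[0,T]\times\mathbb{R}^n\times A\to\mathbb{R}$ are measurable in $t$ for all $(x,a)\in\mathbb{R}^n\times A$ and continuous in $(x,a)$ for all $t\in[0,T]$. Assume that for every $R>0$ there is a measurable map $k_R:[0,T]\to[0,+\infty)$ such that $l(t,\cdot,a)$ is $k_R(t)$-Lipschitz on $\mathbb{B}_R$ for every $t\in[0,T]$ and $a\in A$. Let $H:[0,T]\times\mathbb{R}^n\times\mathbb{R}^n\to\mathbb{R}$ satisfy $$H(t,x,p)=\sup_{a\in A}\{\langle p,f(t,x,a)\rangle-l(t,x,a)\}\quad\text{for all }t\in[0,T],\ x,p\in\mathbb{R}^n,$$ and let $L(t,x,v):=\sup_{p\in\mathbb{R}^n}\{\langle v,p\rangle-H(t,x,p)\}$. Then there exists a map $\lambda:[0,T]\times\mathbb{R}^n\to\mathbb{R}$, measurable in $t$ for every $x\in\mathbb{R}^n$ and continuous in $x$ for every $t\in[0,T]$, such that $L(t,x,v)\le\lambda(t,x)$ for every $(t,x)\in[0,T]\times\mathbb{R}^n$ and every $v\in\operatorname{dom}L(t,x,\cdot)$, and such that for every $R>0$ and $t\in[0,T]$ the function $\lambda(t,\cdot)$ is $k_R(t)$-Lipschitz on $\mathbb{B}_R$ (with the same $k_R$). Moreover, if $f$ and $l$ are continuous (in all variables), then $\lambda$ is also continuous.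
   Context: $\mathbb{B}_R$ is the closed ball in $\mathbb{R}^n$ with centre $0$ and radius $R$. $\operatorname{dom}\varphi=\{x:\varphi(x)\ne\pm\infty\}$. ''Measurable'' means Lebesgue measurable. *)

(* Defs.v *)
From HB Require Import structures.
From mathcomp Require Import all_boot all_order all_algebra.
From mathcomp Require Import all_classical all_reals all_analysis.

Set Implicit Arguments.
Unset Strict Implicit.
Unset Printing Implicit Defensive.

Import Order.TTheory GRing.Theory Num.Theory.
Import numFieldNormedType.Exports.

Local Open Scope classical_set_scope.
Local Open Scope ring_scope.

(* The library norm on ['rV[R]_n] is the sup norm, so the Euclidean structure
   is introduced here; both norms induce the library topology on ['rV[R]_n]. *)
Definition dot (R : realType) (n : nat) (u v : 'rV[R]_n) : R :=
  \sum_(i < n) u 0 i * v 0 i.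

Definition enorm (R : realType) (n : nat) (u : 'rV[R]_n) : R :=
  Num.sqrt (dot u u).

Definition eball (R : realType) (n : nat) (r : R) : set 'rV[R]_n :=
  [set x | enorm x <= r].
Arguments eball {R} n r.

Definition elipschitz_on (R : realType) (n : nat) (c : R) (B : set 'rV[R]_n)
    (g : 'rV[R]_n -> R) : Prop :=
  forall x y, B x -> B y -> `|g x - g y| <= c * enorm (x - y).

(* The canonical sigma-algebra on [R] is the Borel one. Lebesgue measurable sets
   are the Caratheodory measurable sets of Lebesgue outer measure, on which
   [completed_lebesgue_measure] is defined. *)
Definition lebesgue_measurable_fun (R : realType) (d : measure_display)
    (U : measurableType d) (D : set R) (g : R -> U) : Prop :=
  @measurable_fun _ _
    (caratheodory_type
       ((wlength (idfun : R -> R))^*)%mu)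
    U D g.

Definition borel_rV (R : realType) (n : nat) :=
  g_sigma_algebraType (@open 'rV[R]_n).

Definition edom (R : realType) (V : Type) (phi : V -> \bar R) : set V :=
  [set v | phi v \is a fin_num].

Definition conjugate (R : realType) (n : nat) (h : 'rV[R]_n -> R)
    (v : 'rV[R]_n) : \bar R :=
  ereal_sup [set (dot v p - h p)%:E | p in [set: 'rV[R]_n]].

(* Main.v *)
(** The function is [lam t x = max_(a in A) l t x a]. If [L t x v] is finite and
    [e := <v, p> - H t x p - lam t x] were positive for some [p], then
    [<p, v - f t x a> >= e] for every [a] in [A]; along the ray [s *: p] this
    gives [<v, s *: p> - H t x (s *: p) >= s * e + min l], which is unbounded,
    a contradiction. A maximum of functions Lipschitz with the same constant is
    Lipschitz with that constant, compactness of [A] gives continuity, and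
    separability of [A] turns the maximum into a countable supremum, which is
    measurable in [t]. *)

Require Import Defs.
From HB Require Import structures.
From mathcomp Require Import all_boot all_order all_algebra.
From mathcomp Require Import finmap ring lra.
From mathcomp Require Import all_classical all_reals all_analysis.
From mathcomp Require Import measurable_realfun.

Set Implicit Arguments.
Unset Strict Implicit.
Unset Printing Implicit Defensive.

Import Order.TTheory GRing.Theory Num.Theory.
Import numFieldNormedType.Exports.

Local Open Scope classical_set_scope.
Local Open Scope ring_scope.

(** Compactness gives, for each [i], a finite net [B i] in [A] of mesh [1/(i+1)]. The union of these
    nets is countable and dense, and [s] enumerates it. *)
Lemma compact_dense_sequence (R : realType) (m : nat) (A : set 'rV[R]_m) :
  compact A -> A !=set0 ->
  exists2 s : nat -> 'rV[R]_m, (forall i, A (s i)) & A `<=` closure (range s).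
Proof.
move=> Aco A0.
pose f i (z : 'rV[R]_m) : set 'rV[R]_m := (ball z i.+1%:R^-1 : set 'rV[R]_m)°.
have /choice[B hB] : forall i, exists B : set 'rV[R]_m,
    [/\ finite_set B, B `<=` A & A `<=` \bigcup_(z in B) f i z].
  move=> i; have : finite_subset_cover A (f i) A.
    move: Aco; rewrite compact_cover; apply.
      by move=> z _; exact: open_interior.
    by move=> z Az; exists z => //; apply: nbhsx_ballx; rewrite invr_gt0 ltr0n.
  move=> [D DA cD]; exists [set` D]; split=> //.
  by move=> z /DA /set_mem.
(* A countable set is empty or the range of a sequence; emptiness is excluded because the net [B 0]
   covers a point of [A]. *)
have /pfcard_geP[B0|/surjfunPex[s Bs]] : countable (\bigcup_i B i).
- by apply: bigcup_countable => // i _; apply: finite_set_countable; case: (hB i).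
- have [a Aa] := A0; have [_ _ /(_ a Aa)[w wB _]] := hB 0%N.
  by have : (\bigcup_i B i) w by [exists 0%N]; rewrite B0.
exists s => [i|a Aa U /nbhs_ballP[e /= e0 eU]].
  have : (\bigcup_i B i) (s i) by rewrite Bs; exists i.
  by move=> [j _]; have [_ + _] := hB j; apply.
have [//|N] := @ltr_add_invr R 0 e; rewrite add0r => Ne.
have [_ _ /(_ a Aa)[w wN fa]] := hB N.
exists w; split; first by rewrite -Bs; exists N.
by apply/eU/(le_ball (ltW Ne)); apply/ball_sym; exact: interior_subset.
Qed.

Lemma le_sup_image (R : realType) (V : Type) (A : set V) (g : V -> R) a :
  has_ubound (g @` A) -> A a -> g a <= sup (g @` A).
Proof. by move=> ub Aa; apply: ub_le_sup => //; exists a. Qed.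

(** Serves with [e] a Lipschitz bound in [x] and with [e] a continuity tolerance; in both cases the
    estimate is uniform in [a]. *)
Lemma dist_sup_le (R : realType) (V : Type) (A : set V) (g h : V -> R) e :
  A !=set0 -> has_ubound (g @` A) -> has_ubound (h @` A) ->
  (forall a, A a -> `|g a - h a| <= e) ->
  `|sup (g @` A) - sup (h @` A)| <= e.
Proof.
move=> A0 gub hub gh; rewrite ler_distl; apply/andP; split.
  rewrite lerBlDr; apply: ge_sup; first exact: image_nonempty.
  move=> _ [a Aa <-]; have := le_sup_image gub Aa; have := gh _ Aa.
  by rewrite ler_distl => /andP[]; lra.
apply: ge_sup; first exact: image_nonempty.
move=> _ [a Aa <-]; have := le_sup_image hub Aa; have := gh _ Aa.
by rewrite ler_distl => /andP[]; lra.
Qed.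

Lemma sup_image_dense (R : realType) (V : topologicalType) (A : set V)
    (s : nat -> V) (g : V -> R) :
  {within A, continuous g} -> has_ubound (g @` A) -> A !=set0 ->
  (forall i, A (s i)) -> A `<=` closure (range s) ->
  sup (range (g \o s)) = sup (g @` A).
Proof.
move=> /subspace_continuousP gc gub A0 As sd.
have sub i : g (s i) <= sup (g @` A) by exact: le_sup_image.
have sub' : has_ubound (range (g \o s)).
  by exists (sup (g @` A)) => _ [i _ <-]; exact: sub.
apply/eqP; rewrite eq_le; apply/andP; split.
  by apply: ge_sup => [|_ [i _ <-]]; [exists (g (s 0%N)); exists 0%N|exact: sub].
apply: ge_sup; first exact: image_nonempty.
move=> _ [a Aa <-]; apply/ler_addgt0Pr => e e0.
(* On a neighbourhood of [a] within [A], [g] stays [e]-close to [g a]; density puts some [s i]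
   there. *)
have /cvgrPdist_lt/(_ e e0) nA := gc a Aa.
have [_ [[i _ <-] /(_ (As i))]] := sd a Aa _ nA.
rewrite ltr_distl => /andP[_ ga].
have : g (s i) <= sup (range (g \o s)) by exact: (le_sup_image (a := i) sub').
by have : g a < g (s i) + e := ga; lra.
Qed.

Lemma continuous_within_section (X V W : topologicalType) (D : set X)
    (A : set V) (g : X -> V -> W) x :
  {within D `*` A, continuous (fun z => g z.1 z.2)} -> D x ->
  {within A, continuous (g x)}.
Proof.
move=> /subspace_continuousP gc Dx; apply/subspace_continuousP => a Aa U gU.
have [[P Q] /= [Px Qa] PQ] := gc (x, a) (conj Dx Aa) U gU.
apply: filterS Qa => a' Qa' Aa'.
exact: (PQ (x, a') (conj (nbhs_singleton Px) Qa') (conj Dx Aa')).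
Qed.

Lemma has_ubound_image_compact (R : realType) (V : topologicalType)
    (A : set V) (g : V -> R) :
  compact A -> A !=set0 -> {within A, continuous g} -> has_ubound (g @` A).
Proof.
move=> Aco A0 gc; have [a _ ga] := compact_EVT_max A0 Aco gc.
by exists (g a) => _ [a' /mem_set Aa' <-]; exact: ga.
Qed.

(* Joint continuity makes [g x] uniformly close to [g x0] on the compact [A]. *)
Lemma continuous_sup_compact (R : realType) (X V : topologicalType)
    (D : set X) (A : set V) (g : X -> V -> R) :
  compact A -> A !=set0 ->
  {within D `*` A, continuous (fun z => g z.1 z.2)} ->
  {within D, continuous (fun x => sup (g x @` A))}.
Proof.
move=> Aco A0 gD.
have gub x : D x -> has_ubound (g x @` A).
  move=> Dx; apply: has_ubound_image_compact => //.
  exact: continuous_within_section gD Dx.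
have /subspace_continuousP gc := gD; apply/subspace_continuousP => x0 Dx0.
apply/cvgrPdist_le => e e0.
(* The near-covering form of compactness reduces uniformity in [a] to the local estimate [h]; the
   filter lets [x] approach [x0] inside [D] only. *)
have /compact_near_coveringP/near_covering_withinP/(_ X (within D (nbhs x0))
  (fun x a => `|g x0 a - g x a| <= e)) := Aco.
have h : forall a, A a -> \forall a' \near a & x \near within D (nbhs x0),
    A a' -> `|g x0 a' - g x a'| <= e.
  move=> a Aa.
  (* Both [g x a'] and [g x0 a'] are compared with [g x0 a], at a cost of [e / 2] each. *)
  have /cvgrPdist_lt/(_ (e / 2)) := gc (x0, a) (conj Dx0 Aa).
  rewrite divr_gt0// => /(_ isT) [[P Q] /= [Px Qa] PQ].
  exists (Q, D `&` P) => /=.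
    by split=> //; apply: filterI; [exact: withinT|exact: cvg_within].
  move=> [a' x] /= [Qa' [Dx Px']] Aa'.
  have : `|g x0 a - g x a'| < e / 2 := PQ (x, a') (conj Px' Qa') (conj Dx Aa').
  have : `|g x0 a - g x0 a'| < e / 2 :=
    PQ (x0, a') (conj (nbhs_singleton Px) Qa') (conj Dx0 Aa').
  by rewrite /= ler_distl !ltr_distl => /andP[? ?] /andP[? ?]; lra.
move=> /(_ _ h); apply: filter_app; near=> x => gx.
apply: dist_sup_le => //; apply: gub => //.
by near: x; exact: withinT.
Unshelve. all: by end_near. Qed.

(** The measurable space is arbitrary so that the lemma applies to the Lebesgue sigma-algebra,
    carried by [caratheodory_type]. *)
Lemma measurable_sup_compact (R : realType) (d : measure_display)
    (T : measurableType d) (m : nat) (D : set T) (A : set 'rV[R]_m)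
    (g : T -> 'rV[R]_m -> R) :
  compact A -> A !=set0 ->
  (forall t, D t -> {within A, continuous (g t)}) ->
  (forall a, A a -> measurable_fun D (g ^~ a)) ->
  measurable_fun D (fun t => sup (g t @` A)).
Proof.
move=> Aco A0 gc gm.
have gub t : D t -> has_ubound (g t @` A).
  by move=> Dt; apply: has_ubound_image_compact => //; exact: gc.
have [s As sd] := compact_dense_sequence Aco A0.
(* [sups u 0] is the supremum over all indices from [0] on, hence over the whole range. *)
have supsE t : D t -> sups (fun i => g t (s i)) 0%N = sup (g t @` A).
  move=> Dt; rewrite -(sup_image_dense (gc t Dt) (gub t Dt) A0 As sd).
  by congr sup; apply/seteqP; split=> _ [i _ <-]; exists i.
apply: (@eq_measurable_fun _ _ _ _ _ (fun t => sups (fun i => g t (s i)) 0%N)).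
  by move=> t /set_mem /supsE.
apply: measurable_fun_sups => [t Dt|i]; last exact: gm.
exists (sup (g t @` A)) => _ [i _ <-].
exact: le_sup_image (gub t Dt) (As i).
Qed.

Lemma edom_conjugate_le (R : realType) (n : nat) (V : Type) (A : set V)
    (f : V -> 'rV[R]_n) (l : V -> R) (h : 'rV[R]_n -> R) (v : 'rV[R]_n)
    (c b : R) :
  (forall p, (h p)%:E = ereal_sup [set (dot p (f a) - l a)%:E | a in A]) ->
  (forall a, A a -> b <= l a <= c) ->
  edom (conjugate h) v -> (conjugate h v <= c%:E)%E.
Proof.
move=> hE lbc vdom; apply: ge_ereal_sup => _ [p _ <-]; rewrite lee_fin leNgt.
apply/negP => cp; set e := dot v p - h p - c.
have e0 : 0 < e by rewrite /e; lra.
have dotvp u (a : R) : dot v (a *: u) = a * dot v u.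
  by rewrite /dot mulr_sumr; apply: eq_bigr => i _; rewrite mxE; ring.
have dotpv u w (a : R) : dot (a *: u) w = a * dot u w.
  by rewrite /dot mulr_sumr; apply: eq_bigr => i _; rewrite mxE; ring.
have hge q a : A a -> dot q (f a) - l a <= h q.
  by move=> Aa; rewrite -lee_fin hE; apply: ereal_sup_ubound; exists a.
(* Since [l a <= c], the choice of [e] gives [dot p (f a) <= dot v p - e] for every [a]. Scaling by
   [s] and using [b <= l a] bounds [h (s *: p)]. *)
have ray s : 0 <= s -> s * e + b <= dot v (s *: p) - h (s *: p).
  move=> s0; suff: h (s *: p) <= s * (dot v p - e) - b by rewrite dotvp; lra.
  rewrite -lee_fin hE; apply: ge_ereal_sup => _ [a Aa <-].
  rewrite lee_fin dotpv.
  have := hge p a Aa; have /andP[] := lbc a Aa; rewrite /e => la lb hp.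
  have : s * dot p (f a) <= s * (dot v p - e).
    by apply: ler_wpM2l => //; rewrite /e; lra.
  by rewrite /e; lra.
move: vdom; rewrite /edom /= => /fineK vfin.
set C := fine _ in vfin.
(* With this [s], [s * e + b] is at least [|C| + 1], which exceeds the supposed finite value [C] of
   the conjugate. *)
pose s := (`|C| + `|b| + 1) / e.
have s0 : 0 <= s by rewrite divr_ge0// ?ltW// ltr_wpDl// addr_ge0.
have : dot v (s *: p) - h (s *: p) <= C.
  by rewrite -lee_fin vfin; apply: ereal_sup_ubound; exists (s *: p).
have := ray s s0; rewrite {1}/s divfK ?gt_eqF//.
have := ler_norm C; have := ler_norm (- b); rewrite normrN; lra.
Qed.

Theorem theorem3p1 (R : realType) (T : R) (n m : nat) (A : set 'rV[R]_m)
    (f : R -> 'rV[R]_n -> 'rV[R]_m -> 'rV[R]_n)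
    (l : R -> 'rV[R]_n -> 'rV[R]_m -> R)
    (k : R -> R -> R)
    (H : R -> 'rV[R]_n -> 'rV[R]_n -> R)
    (L : R -> 'rV[R]_n -> 'rV[R]_n -> \bar R)
    (I := `[0, T]%classic : set R)
    (T_gt0 : 0 < T)
    (n_ge1 : (1 <= n)%N)
    (A_neq0 : A !=set0)
    (A_compact : compact A)
    (f_meas : forall x a, A a ->
       lebesgue_measurable_fun I (fun t => f t x a : borel_rV R n))
    (l_meas : forall x a, A a -> lebesgue_measurable_fun I (fun t => l t x a))
    (f_cont : forall t, I t ->
       {within [set: 'rV[R]_n] `*` A, continuous (fun z => f t z.1 z.2)})
    (l_cont : forall t, I t ->
       {within [set: 'rV[R]_n] `*` A, continuous (fun z => l t z.1 z.2)})
    (k_meas : forall r, 0 < r -> lebesgue_measurable_fun I (k r))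
    (k_ge0 : forall r t, 0 < r -> I t -> 0 <= k r t)
    (l_lip : forall r t a, 0 < r -> I t -> A a ->
       elipschitz_on (k r t) (eball n r) (fun x => l t x a))
    (H_def : forall t x p, I t ->
       (H t x p)%:E = ereal_sup [set (dot p (f t x a) - l t x a)%:E | a in A])
    (L_def : forall t x v, I t -> L t x v = conjugate (H t x) v) :
  exists lam : R -> 'rV[R]_n -> R,
    [/\ forall x, lebesgue_measurable_fun I (fun t => lam t x),
        forall t, I t -> continuous (lam t),
        forall t x v, I t -> edom (L t x) v -> (L t x v <= (lam t x)%:E)%E,
        forall r t, 0 < r -> I t ->
          elipschitz_on (k r t) (eball n r) (lam t)
      & {within I `*` [set: 'rV[R]_n] `*` A,
           continuous (fun z => f z.1.1 z.1.2 z.2)} ->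
        {within I `*` [set: 'rV[R]_n] `*` A,
           continuous (fun z => l z.1.1 z.1.2 z.2)} ->
        {within I `*` [set: 'rV[R]_n],
           continuous (fun z => lam z.1 z.2)}].
Proof.
have lA t x : I t -> {within A, continuous (l t x)}.
  by move=> It; exact: continuous_within_section (l_cont t It) _.
(* The real [sup] defaults to [0] on sets unbounded above, so this bound is what makes it a true
   supremum. *)
have lub t x : I t -> has_ubound (l t x @` A).
  by move=> It; apply: has_ubound_image_compact => //; exact: lA.
exists (fun t x => sup (l t x @` A)); split.
- move=> x.
  apply: (@measurable_sup_compact R _
    (caratheodory_type ((wlength (idfun : R -> R))^*)%mu) m I A
    (fun t => l t x)) => // [t|a].
    exact: lA.
  exact: l_meas.
- move=> t It; apply/continuous_subspace_setT.
  apply: (continuous_sup_compact (g := l t) A_compact) => //.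
  exact: l_cont.
- move=> t x v It; rewrite /edom /= L_def// => vdom.
  (* The minimum of [l t x] on [A] serves as the lower bound [b], the supremum as [c]. *)
  have [a0 /set_mem Aa0 lea] := compact_EVT_min A_neq0 A_compact (lA t x It).
  apply: (edom_conjugate_le (A := A) (f := f t x) (l := l t x)
    (b := l t x a0)) => //.
  - by move=> p; rewrite H_def.
  - by move=> a Aa; rewrite lea ?inE//=; exact: le_sup_image (lub t x It) Aa.
- move=> r t r0 It x y Bx By; apply: dist_sup_le => //; [exact: lub|exact: lub|].
  by move=> a Aa; exact: l_lip.
- move=> _ lc.
  (* The pair [(t, x)] is now the parameter, ranging over [I] times the whole space. *)
  apply: (@continuous_sup_compact _ _ _ _ A (fun z a => l z.1 z.2 a)) => //.
Qed.
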